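(* Let $\kappa$ be inaccessible and let $b,h:\kappa\to\kappa$ be increasing functions with $h\leq b$, each $b(\alpha)$ an infinite cardinal and each $h(\alpha)$ a nonzero cardinal. Assume: (1) for every regular cardinal $\lambda<\kappa$ the set $\{\alpha\in\kappa\mid\mathrm{cf}(b(\alpha))=\lambda\}$ is bounded in $\kappa$, and there is a club set $C\subseteq\kappa$ such that for each $\xi\in C$ we have $\mathrm{cf}(b(\alpha))>\xi$ for all $\alpha\geq\xi$; (2) for every cardinal $\lambda<\kappa$ the set $\{\alpha\in\kappa\mid h(\alpha)=\lambda\}$ is bounded in $\kappa$, and $h$ is discontinuous on a club set; (3) for every cardinal $\lambda<\kappa$ the set $\{\alpha\in\kappa\mid b(\alpha)\leq\lambda\}\cup\{\alpha\in\kappa\mid h(\alpha)=b(\alpha)\text{ and }\mathrm{cf}(b(\alpha))\leq\lambda\}$ is bounded in $\kappa$, and there is a club set $C\subseteq\kappa$ such that $b$ is discontinuous on $C$ and for each $\xi\in C$ and $\alpha\geq\xi$, if $h(\alpha)=b(\alpha)$, then $\mathrm{cf}(b(\alpha))>\xi$. Then the following Tukey connections exist: $\mathcal{ED}_b\preceq\mathcal{AL}_{b,h}$, $\mathcal{ED}_b\preceq\mathcal D_b$, $\mathcal D_b^\bot\preceq\mathcal D_b$, and $\mathcal{AL}_{b,h}^\bot\preceq\mathcal L_{b,h}$. If additionally $h(\alpha)\leq\mathrm{cf}(b(\alpha))$ for all but boundedly many $\alpha\in\kappa$, then also $\mathcal{AL}_{b,h}\preceq\mathcal D_b$, $\mathcal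 D_b\preceq\mathcal L_{b,h}$, and $\mathcal D_b^\bot\preceq\mathcal{AL}_{b,h}^\bot$.
   Context: ''Increasing'' means not necessarily strictly increasing. An increasing function $g:\kappa\to\mathrm{Ord}$ is discontinuous on $A\subseteq\kappa$ if $g(\gamma)>\bigcup_{\alpha<\gamma}g(\alpha)$ for every limit ordinal $\gamma\in A$. $\prod b$ is the set of functions $f$ with domain $\kappa$ and $f(\alpha)\in b(\alpha)$ for all $\alpha$. $\mathrm{Loc}_\kappa^{b,h}$ is the set of functions $\phi$ with domain $\kappa$ such that $\phi(\alpha)\subseteq b(\alpha)$ and $|\phi(\alpha)|<h(\alpha)$ for all $\alpha$. ''Almost all $\alpha$'' means all $\alpha$ above some $\beta<\kappa$; ''cofinally many'' means unboundedly many in $\kappa$. $f\leq^*g$ iff $f(\alpha)\leq g(\alpha)$ for almost all $\alpha$; $f=^\infty g$ iff $f(\alpha)=g(\alpha)$ for cofinally many $\alpha$; $f\in^*\phi$ iff $f(\alpha)\in\phi(\alpha)$ for almost all $\alpha$; $\phi\ni^\infty f$ iff $f(\alpha)\in\phi(\alpha)$ for cofinally many $\alpha$; $\not=^\infty$ and $\not\ni^\infty$ are the negations of $=^\infty$ and $\ni^\infty$. A relational system is a triple $\mathcal R=\langle X,Y,R\rangle$ with $R\subseteq X\times Y$; its dual is $\mathcal R^\bot=\langle Y,X,\{(y,x)\mid(x,y)\notin R\}\rangle$. A Tukey connection witnessing $\mathcal R\preceq\mathcal R'=\langle X',Y',R'\rangle$ is a pair of functions $\rho_-:X\to X'$, $\rho_+:Y'\to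 Y$ such that for all $x\in X$, $y'\in Y'$, $(\rho_-(x),y')\in R'$ implies $(x,\rho_+(y'))\in R$. The systems are $\mathcal D_b=\langle\prod b,\prod b,\leq^*\rangle$, $\mathcal{ED}_b=\langle\prod b,\prod b,\not=^\infty\rangle$, $\mathcal L_{b,h}=\langle\prod b,\mathrm{Loc}_\kappa^{b,h},\in^*\rangle$, $\mathcal{AL}_{b,h}=\langle\mathrm{Loc}_\kappa^{b,h},\prod b,\not\ni^\infty\rangle$. *)

(* Defs.v *)
From mathcomp Require Import all_boot all_order.
From mathcomp Require Import mathcomp_extra boolp classical_sets functions.
From mathcomp Require Import cardinality.
From mathcomp Require wochoice.

Set Implicit Arguments.
Unset Strict Implicit.
Unset Printing Implicit Defensive.

Local Open Scope classical_set_scope.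
Local Open Scope card_scope.
Local Open Scope order_scope.

(* The ordinal kappa is a well-ordered type K; the ordinals below kappa are the
   elements of K.  An ordinal [a < kappa], seen as a set of ordinals, is its set
   [below a] of predecessors, so [a] is the union of a family of ordinals when
   [below a] is the union of their sets of predecessors. *)

Definition below {d} {K : orderType d} (a : K) : set K := [set x | x < a].

Definition card_lt {T U} (A : set T) (B : set U) : Prop :=
  A #<= B /\ ~ (B #<= A).

Section Ordinals.
Context {d : Order.disp_t} {K : orderType d}.
Implicit Types (a b g l x y : K) (A C : set K) (f : K -> K) (P : K -> Prop).

Definition is_card a : Prop := forall x, x < a -> ~ (below x #= below a).

Definition is_infinite_card a : Prop := is_card a /\ infinite_set (below a).

Definition is_nonzero_card a : Prop := is_card a /\ below a !=set0.

Definition cofinal_in a l f : Prop :=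
  (forall y, y < l -> f y < a) /\
  (forall x, x < a -> exists2 y, y < l & x <= f y).

Definition has_cofinal a l : Prop := exists f, cofinal_in a l f.

(* The least length of a cofinal map into [a]; it exists for a well-ordered K,
   as the identity is cofinal in [a], so the default value [a] of [xget] is
   irrelevant. *)
Definition cf a : K :=
  xget a [set l | has_cofinal a l /\ forall l', has_cofinal a l' -> l <= l'].

Definition is_regular_card a : Prop := is_infinite_card a /\ cf a = a.

Definition is_limit g : Prop :=
  below g !=set0 /\ (forall a, a < g -> exists2 x, a < x & x < g).

Definition unbounded A : Prop := ~ has_ubound A.

Definition is_club C : Prop :=
  unbounded C /\
  (forall g, is_limit g ->
    (forall a, a < g -> exists x, [/\ C x, a < x & x < g]) -> C g).

Definition increasing f : Prop := {homo f : x y / x <= y}.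

Definition discontinuous_on f A : Prop :=
  forall g, A g -> is_limit g ->
    exists2 s, below s = \bigcup_(a in below g) below (f a) & s < f g.

Definition almost_all P : Prop := exists b, forall a, b < a -> P a.

Definition cofinally_many P : Prop := unbounded [set a | P a].

End Ordinals.

(* kappa, the order type of K, is an uncountable regular strong limit cardinal.
   The third clause says that kappa is an initial ordinal, the fourth one that
   cf(kappa) = kappa. *)
Definition inaccessible {d} (K : orderType d) : Prop :=
  [/\ wochoice.well_order (fun x y : K => x <= y),
      ~ countable [set: K],
      forall a : K, ~ (below a #= [set: K]),
      forall (a : K) (f : K -> K), has_ubound [set f y | y in below a] &
      forall a : K, card_lt [set B : set K | B `<=` below a] [set: K]].

Record rel_system := RelSystem {
  challenges : Type;
  responses : Type;
  rel_of : challenges -> responses -> Prop }.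

Definition dual (R : rel_system) : rel_system :=
  RelSystem (fun y x => ~ rel_of (r := R) x y).

Definition tukey (R R' : rel_system) : Prop :=
  exists (rm : challenges R -> challenges R')
         (rp : responses R' -> responses R),
    forall x y', rel_of (rm x) y' -> rel_of x (rp y').

Section Systems.
Context {d : Order.disp_t} {K : orderType d}.
Implicit Types (b h : K -> K).

Definition prod_of b : set (K -> K) :=
  [set f | forall a, below (b a) (f a)].

Definition Loc b h : set (K -> set K) :=
  [set phi | forall a, phi a `<=` below (b a) /\
                       card_lt (phi a) (below (h a))].

Definition le_ast (f g : K -> K) : Prop := almost_all (fun a => f a <= g a).

Definition eq_inf (f g : K -> K) : Prop := cofinally_many (fun a => f a = g a).

Definition in_ast (f : K -> K) (phi : K -> set K) : Prop :=
  almost_all (fun a => phi a (f a)).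

Definition ni_inf (phi : K -> set K) (f : K -> K) : Prop :=
  cofinally_many (fun a => phi a (f a)).

Definition sysD b : rel_system :=
  RelSystem (fun f g : prod_of b => le_ast (val f) (val g)).

Definition sysED b : rel_system :=
  RelSystem (fun f g : prod_of b => ~ eq_inf (val f) (val g)).

Definition sysL b h : rel_system :=
  RelSystem (fun (f : prod_of b) (phi : Loc b h) => in_ast (val f) (val phi)).

Definition sysAL b h : rel_system :=
  RelSystem (fun (phi : Loc b h) (f : prod_of b) => ~ ni_inf (val phi) (val f)).

End Systems.

(* Main.v *)
(** All the connections act pointwise: a single value is a slalom of width 1
as soon as [h > 1], and since [b a] is a limit, passing from [g] to its successor
turns domination into eventual difference and into non-domination. When
[h <= cf b], the set [phi a] has fewer than [cf (b a)] elements, hence is bounded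
in [b a]; the bounds form a function which dominates whatever [phi] localizes,
and any function dominating these bounds is met by [phi] only boundedly often. *)

Require Import Defs.
From mathcomp Require Import all_boot all_order.
From mathcomp Require Import mathcomp_extra boolp classical_sets functions.
From mathcomp Require Import cardinality.
From mathcomp Require wochoice.

Set Implicit Arguments.
Unset Strict Implicit.
Unset Printing Implicit Defensive.

Import Order.TTheory.

Local Open Scope classical_set_scope.
Local Open Scope card_scope.
Local Open Scope order_scope.

(** * Duality and preliminaries on cardinality *)

Lemma tukey_dual (R R' : rel_system) : tukey R R' -> tukey (dual R') (dual R).
Proof.
move=> [rm [rp H]]; exists rp, rm => y x /= nR R'xy.
exact/nR/H.
Qed.

Lemma injfun_card_le {T U} {A : set T} {B : set U} (f : T -> U) :
  set_fun A B f -> set_inj A f -> A #<= B.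
Proof.
move=> fAB finj.
have : $|{injfun A >-> B}| by apply/injfunPex; exists f.
by case=> g; apply: inj_card_le.
Qed.

(* Hilbert's hotel. *)
Lemma infinite_setU1_card_le T (A : set T) (x : T) :
  infinite_set A -> x |` A #<= A.
Proof.
elim/Ppointed: T => T in A x *; first by case: (no x).
case: (pselect (A x)) => [Ax _|nAx /infiniteP/pcard_leP/injfunPex[i iA iinj]].
  by rewrite setUidr// => _ ->.
(* The sequence [j] runs through [x], [i 0], [i 1], and so on. The map [f] below moves each of its
   terms to the next one and fixes everything else, so the added point lands in [A]. *)
pose j n := if n is m.+1 then i m else x.
have jinj m n : j m = j n -> m = n.
  case: m n => [|m] [|n] //= jmn.
  - by case: nAx; rewrite jmn; apply: iA.
  - by case: nAx; rewrite -jmn; apply: iA.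
  - by congr _.+1; apply: iinj; rewrite ?inE.
pose f z := if pselect (exists n, z = j n) is left ex then i (sval (cid ex)) else z.
have fj n : f (j n) = i n.
  rewrite /f; case: pselect => [ex|]; last by case; exists n.
  by case: cid => m /= /jinj ->.
have fN z : ~ (exists n, z = j n) -> f z = z by rewrite /f; case: pselect.
apply: (@injfun_card_le _ _ _ _ f).
- move=> z [->|Az] /=; first by rewrite (fj 0%N); apply: iA.
  case: (pselect (exists n, z = j n)) => [[n ->]|/fN->//].
  by rewrite fj; apply: iA.
- move=> y z _ _.
  case: (pselect (exists n, y = j n)) => [[m ->]|Ny];
  case: (pselect (exists n, z = j n)) => [[n ->]|Nz].
  + by rewrite !fj => e; congr j; apply: iinj; rewrite ?inE.
  + by rewrite fj fN// => e; case: Nz; exists m.+1.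
  + by rewrite fj fN// => e; case: Ny; exists n.+1.
  + by rewrite !fN.
Qed.

(** * Well-orders: enumeration and cofinality *)

Section WellOrder.
Context {d : Order.disp_t} {K : orderType d}.
Hypothesis K_wo : wochoice.well_order (fun x y : K => x <= y).
Implicit Types (a l x y : K) (P : set K).

Lemma well_order_least P :
  P !=set0 -> exists2 x, P x & forall y, P y -> x <= y.
Proof.
move=> [z Pz]; have [|x [[Px xmin] _]] := @K_wo [pred y | `[< P y >]].
  by exists z; apply/asboolP.
exists x; first exact/asboolP.
by move=> y Py; apply: xmin; apply/asboolP.
Qed.

Lemma well_order_wf : well_founded (fun x y : K => x < y).
Proof.
move=> z; apply: contrapT => nz.
have [x nx xmin] : exists2 x, ~ Acc (fun x y : K => x < y) x &
    forall y, ~ Acc (fun x y : K => x < y) y -> x <= y.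
  by apply: (@well_order_least [set x | ~ Acc _ x]); exists z.
apply: nx; constructor=> y yx; apply: contrapT => /xmin.
by rewrite leNgt yx.
Qed.

(* [A] is enumerated by recursion along [K], choosing at each step a new
   element, until it is exhausted. *)
Lemma below_card_le_or_enum (T : choiceType) (t0 : T) (A : set T) l :
  below l #<= A \/
  exists2 l', l' < l & exists f : K -> T,
    A `<=` f @` below l' /\ f @` below l' `<=` A.
Proof.
(* The default [t0] is returned only once [A] is exhausted by the earlier values. *)
pose F y (rec : forall z, z < y -> T) :=
  xget t0 (A `\` [set t | exists z (zy : z < y), t = rec z zy]).
pose e := Fix well_order_wf (fun=> T) F.
have eE y : e y = xget t0 (A `\` e @` below y).
  rewrite /e Fix_eq => [|x f g fg]; last first.
    by congr F; apply: functional_extensionality_dep => z;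
       apply: functional_extensionality_dep.
  rewrite {1}/F; congr (xget _ (_ `\` _)); apply/seteqP; split=> t /=.
    by move=> [z [zy ->]]; exists z.
  by move=> [z zy <-]; exists z, zy.
have eA y : ~ (A `<=` e @` below y) -> (A `\` e @` below y) (e y).
  move=> nsub; rewrite eE; apply: xgetPex; apply: contrapT => nex.
  by apply: nsub => t At; apply: contrapT => nt; apply: nex; exists t.
case: (pselect (exists2 y, y < l & A `<=` e @` below y)) => [[y0 y0l y0A]|nex].
  (* At the least stage where [A] is exhausted, all earlier values are genuine choices rather than
     defaults, hence lie in [A]. *)
  right; have [|y yA ymin] := @well_order_least [set y | A `<=` e @` below y].
    by exists y0.
  exists y; first exact: le_lt_trans (ymin _ y0A) y0l.
  exists e; split=> // t [z zy <-].
  have [] // := eA z; first by move=> /ymin; rewrite leNgt zy.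
have {}eA y : y < l -> (A `\` e @` below y) (e y).
  by move=> yl; apply: eA => yA; apply: nex; exists y.
left; apply: (@injfun_card_le _ _ _ _ e) => [y yl|y z]; first by have [] := eA y yl.
rewrite !inE => yl zl eyz; case: (ltgtP y z) => // [yz|zy].
- by have [_] := eA z zl; case; exists y.
- by have [_] := eA y yl; case; exists z.
Qed.

Lemma cf_le a l : has_cofinal a l -> cf a <= l.
Proof.
move=> al; rewrite /cf; set S := [set l | _].
have [m am mmin] := @well_order_least (has_cofinal a) (ex_intro _ l al).
by have /(_ _)[|_] := @xgetPex _ a S; [exists m | apply].
Qed.

(** Since [below (cf a)] does not inject into [A], the set [A] is enumerated along some [l < cf a].
    If [A] were unbounded in [a], this enumeration would be a cofinal map of length less than
    [cf a]. *)
Lemma card_lt_cf_bounded a (A : set K) :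
  A `<=` below a -> card_lt A (below (cf a)) ->
  exists2 s, s < a & forall x, A x -> x < s.
Proof.
move=> Aa [_ nle]; have [//|[l lcf [f [Af fA]]]] := below_card_le_or_enum a A (cf a).
apply: contrapT => nbound; have : cf a <= l; last by rewrite leNgt lcf.
apply: cf_le; exists f; split=> [y yl|x xa]; first by apply/Aa/fA; exists y.
apply: contrapT => nx; apply: nbound; exists x => // _ /Af[y yl <-].
by rewrite ltNge; apply/negP => xfy; apply: nx; exists y.
Qed.

End WellOrder.

(** * Cardinals as initial ordinals, and quantifiers modulo bounded sets *)

Section Cardinals.
Context {d : Order.disp_t} {K : orderType d}.
Implicit Types (a x : K) (P Q : K -> Prop).

(** If [x] were the largest element of [below a], Hilbert's hotel would make [below a] equinumerous
    with [below x], whereas [a] is an initial ordinal. *)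
Lemma infinite_card_succ a x :
  is_infinite_card a -> x < a -> exists2 y, x < y & y < a.
Proof.
move=> [acard ainf] xa; apply: contrapT => nex.
have xmax y : y < a -> y <= x.
  by move=> ya; rewrite leNgt; apply/negP => xy; apply: nex; exists y.
have aE : below a = x |` below x.
  apply/seteqP; split=> [y /xmax|y [->//|]]; last by move=> /lt_trans; apply.
  by rewrite le_eqVlt => /predU1P[]; [left | right].
apply: (acard x xa); rewrite card_eq_le aE infinite_setU1_card_le ?andbT.
  by apply: subset_card_le => y; right.
move=> xfin; apply: ainf; rewrite aE.
by rewrite finite_setU; split=> //; apply: finite_set1.
Qed.

(** The elements [x < y] witness that [a] exceeds 1: an injection of [below a] into a point would
    identify them. *)
Lemma card_lt_set1 {T} (t : T) a x y :
  x < y -> y < a -> card_lt [set t] (below a).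
Proof.
move=> xy ya; have xa := lt_trans xy ya; split.
  by apply: (@injfun_card_le _ _ _ _ (fun=> x)) => // u v; rewrite !inE => -> ->.
move=> /card_leP[f]; have [x' xE] : exists x' : below a, val x' = x.
  by exists (exist _ x (mem_set xa)).
have [y' yE] : exists y' : below a, val y' = y by exists (exist _ y (mem_set ya)).
have : x' = y'.
  apply: (@inj _ _ _ f); rewrite ?inE//; apply/val_inj.
  by rewrite (set_mem (valP (f x'))) (set_mem (valP (f y'))).
by move=> /(congr1 val); rewrite xE yE => xyE; rewrite xyE ltxx in xy.
Qed.

Lemma card_lt0 {T U} (B : set U) : B !=set0 -> card_lt (@set0 T) B.
Proof. by move=> [x Bx]; split=> // /card_le0P B0; rewrite B0 in Bx. Qed.

Lemma card_lt_le {T} {U} {V} (A : set T) (B : set U) (C : set V) :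
  card_lt A B -> B #<= C -> card_lt A C.
Proof.
move=> [AB nBA] BC; split; first exact: card_le_trans AB BC.
by move=> CA; apply: nBA; apply: card_le_trans BC CA.
Qed.

Lemma almost_allW P Q : almost_all P -> (forall a, P a -> Q a) -> almost_all Q.
Proof. by move=> [c Pc] PQ; exists c => a /Pc/PQ. Qed.

Lemma almost_allI P Q :
  almost_all P -> almost_all Q -> almost_all (fun a => P a /\ Q a).
Proof.
move=> [c Pc] [c' Qc']; exists (Order.max c c') => a.
by rewrite gt_max => /andP[/Pc ? /Qc'].
Qed.

Lemma cofinally_manyW P Q :
  almost_all (fun a => P a -> Q a) -> cofinally_many P -> cofinally_many Q.
Proof.
move=> [c Pc] Punb [m mQ]; apply: Punb; exists (Order.max c m) => a Pa.
rewrite le_max; case: (leP a c) => //= ca.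
exact/mQ/Pc.
Qed.

Lemma almost_all_not_cofinally P :
  almost_all (fun a => ~ P a) -> ~ cofinally_many P.
Proof.
move=> [c cP]; apply; exists c => a Pa; rewrite leNgt.
by apply/negP => /cP.
Qed.

End Cardinals.

(** * Consequences of inaccessibility *)

Section Inaccessible.
Context {d : Order.disp_t} {K : orderType d}.
Hypothesis K_inacc : inaccessible K.
Implicit Types P : K -> Prop.

(** Hilbert's hotel again, now against kappa being an initial ordinal; [below a] is infinite because
    [K] is uncountable. *)
Lemma inaccessible_no_max (a : K) : exists x, a < x.
Proof.
have [_ Kunc Kinit _ _] := K_inacc; apply: contrapT => nex.
have amax y : y <= a by rewrite leNgt; apply/negP => ay; apply: nex; exists y.
have KE : [set: K] = a |` below a.
  apply/seteqP; split=> // y _.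
  by have := amax y; rewrite le_eqVlt => /predU1P[]; [left | right].
apply: (Kinit a); rewrite card_eq_le KE infinite_setU1_card_le ?andbT.
  by apply: subset_card_le => y; right.
move=> afin; apply: Kunc; apply: finite_set_countable; rewrite KE.
by rewrite finite_setU; split=> //; apply: finite_set1.
Qed.

Lemma almost_all_cofinally P : almost_all P -> cofinally_many P.
Proof.
move=> [c cP] [m mP].
have [x] := inaccessible_no_max (Order.max c m); rewrite gt_max => /andP[cx mx].
by have := mP x (cP x cx); rewrite leNgt mx.
Qed.

(** One value above 1 suffices, by monotonicity. Without any, [h] is constant, and its only fibre is
    all of [K], which is unbounded. *)
Lemma almost_all_gt1 (h : K -> K) : increasing h ->
  (forall a, is_nonzero_card (h a)) ->
  (forall l, is_card l -> has_ubound [set a | h a = l]) ->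
  almost_all (fun a => exists x y : K, x < y /\ y < h a).
Proof.
move=> h_incr h_card hb.
case: (pselect (exists a x y : K, x < y /\ y < h a)) => [[a [x [y [xy yha]]]]|nex].
  exists a => c /ltW ac; exists x, y; split=> //.
  exact: lt_le_trans yha (h_incr _ _ ac).
(* If [h c < h a], then [h c] and any element of the nonzero [h c] are two distinct elements of
   [h a]. *)
have hcst a c : h a <= h c.
  rewrite leNgt; apply/negP => hca; apply: nex.
  by have [_ [x xhc]] := h_card c; exists a, x, (h c).
case: (pselect (exists a : K, True)) => [[a _]|nK].
  have [m mb] := hb _ (h_card a).1.
  have [x mx] := inaccessible_no_max m.
  have : x <= m by apply: mb => /=; apply/eqP; rewrite eq_le !hcst.
  by rewrite leNgt mx.
have [_ Kunc _ _ _] := K_inacc; case: Kunc.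
suff -> : [set: K] = set0 by [].
by apply/seteqP; split=> // x _; case: nK; exists x.
Qed.

(** * The pointwise Tukey connections *)

Section Products.
Variables b h : K -> K.
Hypothesis b_card : forall a, is_infinite_card (b a).

(** Where [R a] has no solution below [b a], an arbitrary element is taken, so a condition solvable
    only for almost all [a] still yields a member of the product. *)
Lemma prod_of_choice (R : K -> K -> Prop) : exists g : prod_of b,
  forall a, (exists2 x, x < b a & R a x) -> R a (val g a).
Proof.
have /choice[g gP] a : exists x, x < b a /\ ((exists2 x, x < b a & R a x) -> R a x).
  case: (pselect (exists2 x, x < b a & R a x)) => [[x xb Rx]|nR].
    by exists x.
  by have [x xb] := infinite_setN0 (b_card a).2; exists x; split=> // /nR.
have gprod : prod_of b g by move=> a; have [] := gP a.
by exists (exist _ g (mem_set gprod)) => a /=; have [_] := gP a.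
Qed.

Lemma prod_of_succ : exists s : prod_of b -> prod_of b,
  forall f a, val f a < val (s f) a.
Proof.
suff /choice[s sP] : forall f : prod_of b, exists g : prod_of b, forall a, val f a < val g a.
  by exists s.
move=> f; have [g gP] := prod_of_choice (fun a x => val f a < x).
exists g => a; apply: gP; have [y] := infinite_card_succ (b_card a) (set_mem (valP f) a).
by exists y.
Qed.

Lemma tukey_ED_AL : (forall a, is_nonzero_card (h a)) ->
  almost_all (fun a => exists x y : K, x < y /\ y < h a) ->
  tukey (sysED b) (sysAL b h).
Proof.
move=> h_card h_gt1.
(* The cardinality clause empties [phi f a] where a singleton is too wide, so that [phi f] is a
   slalom at every [a], and not only at almost all. *)
pose phi (f : prod_of b) a := [set x | x = val f a /\ card_lt [set val f a] (below (h a))].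
have phiLoc f : Loc b h (phi f).
  move=> a; split=> [x [-> _]|]; first exact: (set_mem (valP f)).
  case: (pselect (card_lt [set val f a] (below (h a)))) => [lt1|nlt1].
    suff -> : phi f a = [set val f a] by [].
    by apply/seteqP; split=> [x []|x].
  have -> : phi f a = set0 by apply/seteqP; split=> [x []|x].
  by apply: card_lt0; have [] := h_card a.
exists (fun f => exist _ (phi f) (mem_set (phiLoc f))), id => f g /= nni fg.
apply: nni; apply: (cofinally_manyW _ fg).
apply: (almost_allW h_gt1) => a [x [y [xy yh]]] /= fga.
by split; [exact: esym | apply: card_lt_set1 xy yh].
Qed.

Lemma tukey_ED_D : tukey (sysED b) (sysD b).
Proof.
have [s sP] := prod_of_succ; exists id, s => f g /= fg.
apply: almost_all_not_cofinally; apply: (almost_allW fg) => a fga fsg.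
by have /lt_eqF/eqP := le_lt_trans fga (sP g a); apply.
Qed.

Lemma tukey_dual_D_D : tukey (dual (sysD b)) (sysD b).
Proof.
have [s sP] := prod_of_succ; exists id, s => f g /= fg sgf.
(* On the tail common to both assumptions, [g < s g <= f <= g]; the tail is nonempty because [K] has
   no maximum. *)
have : cofinally_many (fun a => val f a <= val g a) by apply: almost_all_cofinally.
apply: almost_all_not_cofinally; apply: (almost_allW sgf) => a sgfa fga.
by have := lt_le_trans (sP g a) (le_trans sgfa fga); rewrite ltxx.
Qed.

Lemma tukey_dual_AL_L : tukey (dual (sysAL b h)) (sysL b h).
Proof.
(* The dual of [sysAL] relates [f] to [phi] by the double negation of [ni_inf], so it remains to
   pass from almost all to cofinally many. *)
exists id, id => f phi /= fphi; apply.
exact: almost_all_cofinally.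
Qed.

(** The bound is strict so that [s phi <= g] at [a] excludes [g a] from [phi a]; domination uses
    only its weak form. *)
Lemma Loc_bound : almost_all (fun a => h a <= cf (b a)) ->
  exists s : Loc b h -> prod_of b, forall phi,
    almost_all (fun a => forall x, val phi a x -> x < val (s phi) a).
Proof.
move=> h_cf; suff /choice[s sP] : forall phi : Loc b h, exists g : prod_of b,
    almost_all (fun a => forall x, val phi a x -> x < val g a) by exists s.
move=> phi.
have [g gP] := prod_of_choice (fun a s => forall x, val phi a x -> x < s).
exists g; apply: (almost_allW h_cf) => a h_cfa; apply: gP.
have [phib phih] := set_mem (valP phi) a.
have [K_wo _ _ _ _] := K_inacc.
apply: (card_lt_cf_bounded K_wo phib); apply: card_lt_le phih _.
by apply: subset_card_le => x /lt_le_trans; apply.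
Qed.

Lemma tukey_AL_D : almost_all (fun a => h a <= cf (b a)) ->
  tukey (sysAL b h) (sysD b).
Proof.
move=> /Loc_bound[s sP]; exists s, id => phi g /= sg.
apply: almost_all_not_cofinally.
apply: (almost_allW (almost_allI (sP phi) sg)) => a [phis sga] /phis.
by rewrite ltNge sga.
Qed.

Lemma tukey_D_L : almost_all (fun a => h a <= cf (b a)) ->
  tukey (sysD b) (sysL b h).
Proof.
move=> /Loc_bound[s sP]; exists id, s => f phi /= fphi.
by apply: (almost_allW (almost_allI (sP phi) fphi)) => a [phis /phis/ltW].
Qed.

End Products.
End Inaccessible.

Theorem theorem4p1 (d : Order.disp_t) (K : orderType d)
  (K_inacc : inaccessible K) (b h : K -> K)
  (b_incr : increasing b) (h_incr : increasing h)
  (h_le_b : forall a, h a <= b a)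
  (b_card : forall a, is_infinite_card (b a))
  (h_card : forall a, is_nonzero_card (h a))
  (hyp1 :
    (forall l : K, is_regular_card l -> has_ubound [set a | cf (b a) = l]) /\
    (exists C : set K, is_club C /\
       forall xi, C xi -> forall a, xi <= a -> xi < cf (b a)))
  (hyp2 :
    (forall l : K, is_card l -> has_ubound [set a | h a = l]) /\
    (exists C : set K, is_club C /\ discontinuous_on h C))
  (hyp3 :
    (forall l : K, is_card l ->
       has_ubound ([set a | b a <= l] `|`
                   [set a | h a = b a /\ cf (b a) <= l])) /\
    (exists C : set K, [/\ is_club C, discontinuous_on b C &
       forall xi a, C xi -> xi <= a -> h a = b a -> xi < cf (b a)])) :
  [/\ tukey (sysED b) (sysAL b h),
      tukey (sysED b) (sysD b),
      tukey (dual (sysD b)) (sysD b) &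
      tukey (dual (sysAL b h)) (sysL b h)] /\
  (almost_all (fun a => h a <= cf (b a)) ->
   [/\ tukey (sysAL b h) (sysD b),
       tukey (sysD b) (sysL b h) &
       tukey (dual (sysD b)) (dual (sysAL b h))]).
Proof.
split=> [|h_cf]; split.
- apply: tukey_ED_AL => //; apply: almost_all_gt1 => //; exact: hyp2.1.
- exact: tukey_ED_D.
- exact: tukey_dual_D_D.
- exact: tukey_dual_AL_L.
- exact: tukey_AL_D.
- exact: tukey_D_L.
- exact/tukey_dual/tukey_AL_D.
Qed.
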